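(* Let $G$ be a simple graph of order $n\ge 2$ with adjacency eigenvalues $\lambda_1\ge\lambda_2\ge\cdots\ge\lambda_n$, let $\boldsymbol{\lambda}=(\lambda_1,\dots,\lambda_n)$, let $r,s>0$ be real numbers, and let $\boldsymbol{\nu}=(\sqrt{rs},0,\dots,0,-\sqrt{rs})\in\mathbb{R}^n$. Then $$\frac{|\lambda_n|}{\sqrt{rs}}\,\boldsymbol{\nu}\;\prec\;\boldsymbol{\lambda}\;\prec\;\frac{\|G\|_\ast}{2\sqrt{rs}}\,\boldsymbol{\nu}.$$
   Context: The eigenvalues of a graph are those of its adjacency matrix. The energy of $G$ is $\|G\|_\ast=|\lambda_1|+\cdots+|\lambda_n|$. For $\boldsymbol{x},\boldsymbol{y}\in\mathbb{R}^n$, $\boldsymbol{x}\prec\boldsymbol{y}$ ($\boldsymbol{x}$ is majorized by $\boldsymbol{y}$) means $\sum_{j=1}^k x_j^{\downarrow}\le\sum_{j=1}^k y_j^{\downarrow}$ for $k=1,\dots,n$, with equality for $k=n$, where $\boldsymbol{x}^{\downarrow}$ is the decreasing rearrangement of $\boldsymbol{x}$. *)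

(* Defs.v *)
From HB Require Import structures.
From mathcomp Require Import all_boot all_order all_algebra.
From mathcomp Require Import reals.

Set Implicit Arguments.
Unset Strict Implicit.
Unset Printing Implicit Defensive.

Import Order.TTheory GRing.Theory Num.Theory.
Local Open Scope ring_scope.

(* The vertices are enumerated by [enum V]; another enumeration only conjugates
   the matrix by a permutation matrix. *)
Definition adjacency (R : realType) (V : finType) (e : rel V) : 'M[R]_#|V| :=
  \matrix_(i, j) (e (enum_val i) (enum_val j))%:R.

(* Eigenvalues are listed with multiplicity.  The length n of the list is not
   tied to m by its type, but the degree of the polynomials forces n = m. *)
Definition eigenvalues_of (R : realType) (m n : nat) (A : 'M[R]_m)
    (l : 'rV[R]_n) : Prop :=
  char_poly A = \prod_(i < n) ('X - (l 0 i)%:P)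
  /\ forall i j : 'I_n, (i <= j)%N -> l 0 j <= l 0 i.

Definition energy (R : realType) (n : nat) (l : 'rV[R]_n) : R :=
  \sum_(i < n) `|l 0 i|.

Definition decreasing_rearrangement (R : realType) (n : nat) (x : 'rV[R]_n) :
    seq R :=
  sort (fun a b => b <= a) [seq x 0 i | i <- enum 'I_n].

Definition majorized (R : realType) (n : nat) (x y : 'rV[R]_n) : Prop :=
  let x' := decreasing_rearrangement x in
  let y' := decreasing_rearrangement y in
  (forall k : nat, (1 <= k <= n)%N ->
     \sum_(j < k) x'`_j <= \sum_(j < k) y'`_j)
  /\ \sum_(j < n) x'`_j = \sum_(j < n) y'`_j.

Definition last_index (n : nat) (n_ge2 : (2 <= n)%N) : 'I_n :=
  Ordinal (etrans (ltn_predL n) (ltnW n_ge2)).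

(* (sqrt (r s), 0, ..., 0, - sqrt (r s)), meant for n >= 2. *)
Definition nu (R : realType) (n : nat) (r s : R) : 'rV[R]_n :=
  \row_(i < n) (if i == 0%N :> nat then Num.sqrt (r * s)
                else if i == n.-1 :> nat then - Num.sqrt (r * s)
                else 0).

(* Main.v *)
Require Import Defs.
From HB Require Import structures.
From mathcomp Require Import all_boot all_order all_algebra.
From mathcomp Require Import reals.
From mathcomp Require Import complex zify lra.

Set Implicit Arguments.
Unset Strict Implicit.
Unset Printing Implicit Defensive.

Import Order.TTheory GRing.Theory Num.Theory.
Local Open Scope ring_scope.

(** Both multiples of [nu] have the form [(t, 0, ..., 0, - t)] with [t >= 0]:
    their sum of the [k] largest entries is [t] for [0 < k < n], and their total
    is zero.  The adjacency matrix has zero diagonal, so the eigenvalues also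
    have total zero; everything reduces to bounding the prefix sums [S_k] of the
    eigenvalues, which are minus the sums of the remaining ones.

    Upper bound: [2 S_k] is the prefix sum minus the suffix sum, hence at most
    the energy ([prefix_sum_le]).

    Lower bound: if the [k]-th eigenvalue is nonnegative, [S_k] is at least the
    largest eigenvalue; otherwise the suffix consists of negative numbers, one
    of which is the smallest eigenvalue, so [S_k] is at least its absolute value
    ([prefix_sum_ge]).  The first case needs the Perron-Frobenius inequality
    between the extreme eigenvalues, [nonneg_mx_eigenvalue_ge].  It is proved
    here through traces instead of Rayleigh quotients: powers of an entrywise
    nonnegative matrix have nonnegative trace, but if the most negative
    eigenvalue dominated the largest one, then the sum of the [k]-th powers of
    the eigenvalues would be negative for some odd [k].  That this sum is the
    trace of the [k]-th power, [mxtrace_exp], comes from Schur triangularization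
    over the complex numbers. *)

(** * Traces of powers *)

Lemma trig_mx_mul (C : comNzRingType) (m : nat) (A B : 'M[C]_m) :
  is_trig_mx A -> is_trig_mx B ->
  is_trig_mx (A *m B) /\ forall i, (A *m B) i i = A i i * B i i.
Proof.
move=> /is_trig_mxP A_trig /is_trig_mxP B_trig; split.
  apply/is_trig_mxP => i j lt_ij; rewrite mxE big1 // => k _.
  have [lt_ik|le_ki] := ltnP i k; first by rewrite A_trig ?mul0r.
  by rewrite B_trig ?mulr0 // (leq_ltn_trans le_ki).
move=> i; rewrite mxE (bigD1 i) //= big1 ?addr0 // => k neq_ki.
have [lt_ik|lt_ki|eq_ik] := ltngtP i k.
- by rewrite A_trig ?mul0r.
- by rewrite B_trig ?mulr0.
- by rewrite (val_inj eq_ik) eqxx in neq_ki.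
Qed.

Lemma trig_mx_exp (C : comNzRingType) (m k : nat) (A : 'M[C]_m) :
  is_trig_mx A -> is_trig_mx (A ^+ k) /\ forall i, (A ^+ k) i i = A i i ^+ k.
Proof.
move=> A_trig; elim: k => [|k [Ak_trig Ak_diag]].
  split=> [|i]; last by rewrite !expr0 mxE eqxx.
  by apply/is_trig_mxP => i j; rewrite mxE -val_eqE => /ltn_eqF->.
have [AAk_trig AAk_diag] := trig_mx_mul A_trig Ak_trig.
by rewrite exprS; split=> // i; rewrite AAk_diag Ak_diag exprS.
Qed.

Lemma char_poly_conj (C : comNzRingType) (m : nat) (P Q A : 'M[C]_m) :
  P *m Q = 1%:M -> char_poly (P *m A *m Q) = char_poly A.
Proof.
move=> PQ1; have PQ1X : map_mx polyC P *m map_mx polyC Q = 1%:M.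
  by rewrite -map_mxM PQ1 map_mx1.
suff -> : char_poly (P *m A *m Q)
    = \det (map_mx polyC P *m char_poly_mx A *m map_mx polyC Q).
  by rewrite !det_mulmx mulrAC -det_mulmx [X in \det X]PQ1X det1 mul1r.
congr (\det _); rewrite /char_poly_mx !map_mxM mulmxBr mulmxBl.
by rewrite scalar_mxC -(mulmxA 'X%:M) PQ1X mulmx1.
Qed.

Lemma exp_mx_conj (C : comNzRingType) (m k : nat) (P Q A : 'M[C]_m) :
  P *m Q = 1%:M -> (P *m A *m Q) ^+ k = P *m A ^+ k *m Q.
Proof.
move=> PQ1; elim: k => [|k IHk]; first by rewrite !expr0 mulmx1 PQ1.
rewrite !exprS IHk -!mulmxE !mulmxA.
by rewrite -(mulmxA (P *m A) Q P) (mulmx1C PQ1) mulmx1.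
Qed.

(** By Schur's theorem the matrix is conjugate to a triangular one, and
    conjugation changes neither the characteristic polynomial nor the traces of
    powers.  The diagonal entries are then the roots, in some order. *)
Lemma mxtrace_exp_closed (C : numClosedFieldType) (m k : nat) (A : 'M[C]_m)
    (l : seq C) :
  char_poly A = \prod_(x <- l) ('X - x%:P) ->
  \tr (A ^+ k) = \sum_(x <- l) x ^+ k.
Proof.
have [m0|m_gt0] := posnP m.
  subst m; rewrite /char_poly det_mx00 => /(congr1 (fun p : {poly C} => size p)).
  rewrite size_prod_XsubC size_poly1 => -[] /esym/size0nil ->.
  by rewrite big_nil /mxtrace big_ord0.
have [P P_unitary] := Schur A m_gt0.
rewrite /similar_to /= conjumx ?unitarymx_unit // => T_trig charA.
have PV : P *m invmx P = 1%:M by rewrite mulmxV ?unitarymx_unit.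
move: charA; rewrite -(char_poly_conj A PV) char_poly_trig //.
have -> : \tr (A ^+ k) = \tr ((P *m A *m invmx P) ^+ k).
  by rewrite exp_mx_conj // mxtrace_mulC mulmxA (mulmx1C PV) mul1mx.
move: (P *m A *m invmx P) T_trig => T T_trig charT.
have /prod_XsubC_eq/(perm_big _) /= <- :
    \prod_(x <- [seq T i i | i <- enum 'I_m]) ('X - x%:P)
    = \prod_(x <- l) ('X - x%:P).
  by rewrite big_map big_enum.
rewrite big_map big_enum; apply: eq_bigr => i _.
exact: (trig_mx_exp k T_trig).2.
Qed.

(** The real case embeds in the complex one, where Schur's theorem holds; the
    embedding is injective, so the identity can be read back. *)
Lemma mxtrace_exp (R : rcfType) (m k : nat) (A : 'M[R]_m) (l : seq R) :
  char_poly A = \prod_(x <- l) ('X - x%:P) ->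
  \tr (A ^+ k) = \sum_(x <- l) x ^+ k.
Proof.
move=> charA; apply: (fmorph_inj (@real_complex R)).
have map_exp : map_mx (@real_complex R) (A ^+ k)
    = map_mx (@real_complex R) A ^+ k.
  elim: k => [|k IHk]; first by rewrite !expr0 map_mx1.
  by rewrite !exprS -mulmxE map_mxM IHk.
rewrite -trace_map_mx map_exp rmorph_sum /=.
rewrite (@mxtrace_exp_closed _ _ _ _ (map (@real_complex R) l)).
  by rewrite big_map; apply: eq_bigr => x _; rewrite rmorphXn.
by rewrite -map_char_poly charA map_prod_XsubC big_map.
Qed.

(** * The extreme eigenvalues of a nonnegative matrix *)

Lemma bernoulli (R : realDomainType) (t : R) (k : nat) :
  0 <= t -> 1 + k%:R * t <= (1 + t) ^+ k.
Proof.
move=> t_ge0; elim: k => [|k IHk]; first by rewrite expr0 mul0r addr0.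
rewrite exprS (le_trans _ (ler_wpM2l _ IHk)) ?addr_ge0 ?ler01 //.
by have := mulr_ge0 (ler0n R k) (sqr_ge0 t); rewrite -natr1; nra.
Qed.

(** The ratio [b / a] is [1 + t] with [t > 0], so by Bernoulli's inequality its
    powers exceed any constant. *)
Lemma odd_exp_dominates (R : archiRealFieldType) (c a b : R) :
  0 <= a -> a < b -> exists2 k, odd k & c * a ^+ k < b ^+ k.
Proof.
rewrite le_eqVlt => /predU1P[<- b_gt0|a_gt0 lt_ab].
  by exists 1%N; rewrite // !expr1 mulr0.
pose t := b / a - 1.
have t_gt0 : 0 < t by rewrite subr_gt0 ltr_pdivlMr ?mul1r.
(* The exponent [2 N + 1] is odd and exceeds [|c| / t]. *)
pose N := Num.bound (`|c| / t); exists N.*2.+1; first by rewrite /= odd_double.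
have -> : b = (1 + t) * a by rewrite /t addrC subrK divfK ?gt_eqF.
rewrite exprMn ltr_pM2r ?exprn_gt0 //.
apply: lt_le_trans (bernoulli _ (ltW t_gt0)).
apply: le_lt_trans (ler_norm c) _.
have : `|c| / t < N%:R by apply/archi_boundP/divr_ge0; rewrite ?normr_ge0 ?ltW.
rewrite ltr_pdivrMr // => /lt_le_trans; apply.
rewrite -[leLHS]add0r lerD ?ler01 // ler_wpM2r ?(ltW t_gt0) // ler_nat.
by lia.
Qed.

Lemma exp_mx_ge0 (R : numDomainType) (m k : nat) (A : 'M[R]_m) :
  (forall i j, 0 <= A i j) -> forall i j, 0 <= (A ^+ k) i j.
Proof.
move=> A_ge0; elim: k => [|k IHk] i j; first by rewrite expr0 mxE ler0n.
by rewrite exprS -mulmxE mxE sumr_ge0 // => h _; rewrite mulr_ge0.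
Qed.

(** If some [x] in [l] were below [- a], an odd power [k] with
    [size l * a ^ k < (- x) ^ k] would make the sum of the [k]-th powers
    negative, since each of the other terms is at most [a ^ k].  But this sum is
    the trace of a nonnegative matrix. *)
Lemma nonneg_mx_eigenvalue_ge (R : realType) (m : nat) (A : 'M[R]_m)
    (l : seq R) (a : R) :
  (forall i j, 0 <= A i j) -> char_poly A = \prod_(x <- l) ('X - x%:P) ->
  0 <= a -> {in l, forall x, x <= a} -> {in l, forall x, - a <= x}.
Proof.
move=> A_ge0 charA a_ge0 le_la x x_l; rewrite lerNl leNgt; apply/negP => lt_ax.
have [k k_odd] := odd_exp_dominates (size l)%:R a_ge0 lt_ax.
rewrite exprNn -signr_odd k_odd expr1 mulN1r => lt_k.
have : 0 <= \tr (A ^+ k) by apply: sumr_ge0 => i _; apply: exp_mx_ge0.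
rewrite (mxtrace_exp _ charA) (big_rem x) //= leNgt => /negP; apply.
have le_rem : \sum_(y <- rem x l) y ^+ k <= \sum_(y <- rem x l) a ^+ k.
  rewrite !big_seq; apply: ler_sum => y /mem_rem y_l.
  have [y_ge0|y_lt0] := leP 0 y; first by rewrite lerXn2r ?nnegrE // le_la.
  by apply: (@le_trans _ _ 0); rewrite ?exprn_ge0 // exprn_odd_le0 // ltW.
suff le_size : \sum_(y <- rem x l) a ^+ k <= (size l)%:R * a ^+ k.
  by move: (le_trans le_rem le_size) lt_k; lra.
rewrite big_const_seq count_predT iter_addr_0 -[leLHS]mulr_natl size_rem //.
by rewrite ler_wpM2r ?exprn_ge0 // ler_nat leq_pred.
Qed.

(** * Majorization between decreasing vectors *)

Definition nonincreasing (R : realType) (n : nat) (x : 'rV[R]_n) : Prop :=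
  forall i j : 'I_n, (i <= j)%N -> x 0 j <= x 0 i.

Lemma sum_decreasing_rearrangement (R : realType) (n k : nat) (x : 'rV[R]_n) :
  nonincreasing x -> (k <= n)%N ->
  \sum_(j < k) (decreasing_rearrangement x)`_j = \sum_(i < n | (i < k)%N) x 0 i.
Proof.
move=> x_dec le_kn; rewrite /decreasing_rearrangement sorted_sort; last first.
- rewrite sorted_map; apply: (sub_sorted (e := relpre val leq)) => [i j|].
    exact: x_dec.
  by rewrite -sorted_map val_enum_ord iota_sorted.
- by move=> b a c le_ba le_cb; apply: le_trans le_ba.
rewrite (big_ord_widen n) //.
apply: eq_bigr => i _; have i_enum : (i < size (enum 'I_n))%N by rewrite size_enum_ord.
by rewrite (nth_map i) // nth_ord_enum.
Qed.

(** For decreasing vectors the rearrangement disappears, and majorization becomes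
    a comparison of prefix sums of entries. *)
Lemma majorized_nonincreasing (R : realType) (n : nat) (x y : 'rV[R]_n) :
  nonincreasing x -> nonincreasing y ->
  (forall k, (0 < k < n)%N ->
     \sum_(i < n | (i < k)%N) x 0 i <= \sum_(i < n | (i < k)%N) y 0 i) ->
  \sum_(i < n) x 0 i = \sum_(i < n) y 0 i ->
  majorized x y.
Proof.
move=> x_dec y_dec le_xy eq_xy.
have total z : \sum_(i < n | (i < n)%N) z 0 i = \sum_(i < n) z 0 i :> R.
  by apply: eq_bigl => i; rewrite ltn_ord.
split=> [k /andP[k_gt0 le_kn]|]; rewrite !sum_decreasing_rearrangement //.
  have [lt_kn|lt_nk|->] := ltngtP k n; first by rewrite le_xy ?k_gt0.
    by rewrite leqNgt lt_nk in le_kn.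
  by rewrite !total eq_xy.
by rewrite !total.
Qed.

Lemma scaled_nu_nonincreasing (R : realType) (n : nat) (c r s : R) :
  0 <= c -> nonincreasing (c *: nu n r s).
Proof.
move=> c_ge0 i j le_ij; rewrite !mxE ler_wpM2l //.
have sqrt_ge0 := sqrtr_ge0 (r * s).
have [i0|i_neq0] := eqVneq (i : nat) 0%N.
  by do ![case: ifP => _]; lra.
have -> : (j == 0%N :> nat) = false by apply/negP => /eqP; lia.
have [i_last|_] := eqVneq (i : nat) n.-1.
  have -> : (j == n.-1 :> nat) by have := ltn_ord j; lia.
  by [].
by case: ifP => _; lra.
Qed.

Lemma sum_scaled_nu (R : realType) (n : nat) (c r s : R) : (2 <= n)%N ->
  \sum_(i < n) (c *: nu n r s) 0 i = 0.
Proof.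
case: n => [|[|n]] // _; rewrite big_ord_recl big_ord_recr /= big1 => [|i _].
  by rewrite !mxE /= eqxx /bump /=; lra.
rewrite !mxE /= /bump /= eqSS; case: eqP => [|_]; last by rewrite mulr0.
by have := ltn_ord i; lia.
Qed.

Lemma prefix_sum_scaled_nu (R : realType) (n k : nat) (c r s : R) :
  (0 < k < n)%N ->
  \sum_(i < n | (i < k)%N) (c *: nu n r s) 0 i = c * Num.sqrt (r * s).
Proof.
move=> /andP[k_gt0 lt_kn]; have n_gt0 := ltn_trans k_gt0 lt_kn.
rewrite (bigD1 (Ordinal n_gt0)) //= big1 => [|i /andP[lt_ik]].
  by rewrite addr0 !mxE.
rewrite -val_eqE /= !mxE => /negbTE ->; case: eqP => [|_]; last by rewrite mulr0.
by lia.
Qed.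

(** The sign of the last entry [x_(k-1)] of the prefix decides: if it is
    nonnegative, so is the whole prefix, which is then at least its first term;
    otherwise the suffix has only negative terms, and the prefix, being its
    opposite, is at least the opposite of the last of them. *)
Lemma prefix_sum_ge (R : realType) (n k : nat) (x : 'rV[R]_n) (i0 il : 'I_n) :
  nonincreasing x -> \sum_(i < n) x 0 i = 0 ->
  i0 = 0%N :> nat -> il = n.-1 :> nat -> - x 0 il <= x 0 i0 ->
  (0 < k < n)%N -> - x 0 il <= \sum_(i < n | (i < k)%N) x 0 i.
Proof.
move=> x_dec x_sum i0E ilE le_x /andP[k_gt0 lt_kn].
have lt_pkn : (k.-1 < n)%N by lia.
have [xk_ge0|xk_lt0] := leP 0 (x 0 (Ordinal lt_pkn)).
  rewrite (bigD1 i0) ?i0E //= (le_trans le_x) // lerDl sumr_ge0 // => i.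
  by move=> /andP[lt_ik _]; rewrite (le_trans xk_ge0) // x_dec //=; lia.
move: x_sum; rewrite (bigID (fun i : 'I_n => (i < k)%N)) /= => /eqP.
rewrite addr_eq0 => /eqP ->; rewrite lerN2 (bigD1 il) ?ilE /=; last by lia.
rewrite gerDl sumr_le0 // => i /andP[le_ki _].
by rewrite (le_trans _ (ltW xk_lt0)) // x_dec //=; lia.
Qed.

(** With total zero, a prefix is minus the complementary suffix, so its double
    is the sum of [x] with signs, which the sum of absolute values bounds. *)
Lemma prefix_sum_le (R : realType) (n k : nat) (x : 'rV[R]_n) :
  \sum_(i < n) x 0 i = 0 ->
  \sum_(i < n | (i < k)%N) x 0 i <= energy x / 2.
Proof.
rewrite /energy (bigID (fun i : 'I_n => (i < k)%N)) /= => x_sum.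
rewrite [X in _ <= X / 2](bigID (fun i : 'I_n => (i < k)%N)) /=.
have le_prefix : \sum_(i < n | (i < k)%N) x 0 i
    <= \sum_(i < n | (i < k)%N) `|x 0 i|.
  by apply: ler_sum => i _; apply: ler_norm.
have le_suffix : - \sum_(i < n | ~~ (i < k)%N) x 0 i
    <= \sum_(i < n | ~~ (i < k)%N) `|x 0 i|.
  by rewrite -sumrN; apply: ler_sum => i _; rewrite -normrN ler_norm.
by move: x_sum le_prefix le_suffix; lra.
Qed.

(** * Adjacency eigenvalues *)

Lemma sum_adjacency_eigenvalues (R : realType) (V : finType) (e : rel V)
    (l : seq R) :
  irreflexive e -> char_poly (adjacency R e) = \prod_(x <- l) ('X - x%:P) ->
  \sum_(x <- l) x = 0.
Proof.
move=> e_irr /(mxtrace_exp 1) tr_l.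
rewrite (eq_bigr (fun x => x ^+ 1)) // -tr_l expr1 /mxtrace big1 // => i _.
by rewrite mxE e_irr.
Qed.

Theorem lemma2p3 (R : realType) (n : nat) (n_ge2 : (2 <= n)%N)
    (V : finType) (cardV : #|V| = n)
    (e : rel V) (e_sym : symmetric e) (e_irr : irreflexive e)
    (lambda : 'rV[R]_n) (lambdaP : eigenvalues_of (adjacency R e) lambda)
    (r s : R) (r_gt0 : 0 < r) (s_gt0 : 0 < s) :
  majorized ((`|lambda 0 (last_index n_ge2)| / Num.sqrt (r * s)) *: nu n r s)
            lambda
  /\ majorized lambda
               ((energy lambda / (2 * Num.sqrt (r * s))) *: nu n r s).
Proof.
case: lambdaP => char_adj lambda_dec.
pose l := [seq lambda 0 i | i <- enum 'I_n].
have char_l : char_poly (adjacency R e) = \prod_(x <- l) ('X - x%:P).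
  by rewrite char_adj big_map big_enum.
have lambda_sum : \sum_(i < n) lambda 0 i = 0.
  by have := sum_adjacency_eigenvalues e_irr char_l; rewrite big_map big_enum.
pose i0 := Ordinal (ltnW n_ge2); pose il := last_index n_ge2.
have le_max i : lambda 0 i <= lambda 0 i0 by apply: lambda_dec.
have ge_min i : lambda 0 il <= lambda 0 i.
  by apply: lambda_dec => /=; have := ltn_ord i; lia.
have sumC c : \sum_(i < n) c = n%:R * c :> R.
  by rewrite sumr_const card_ord mulr_natl.
have n_gt0 : 0 < n%:R :> R by rewrite ltr0n ltnW.
(* Both extreme eigenvalues are compared with the mean, which is zero. *)
have max_ge0 : 0 <= lambda 0 i0.
  by rewrite -(pmulr_rge0 _ n_gt0) -lambda_sum -sumC; apply: ler_sum => i _.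
have min_le0 : lambda 0 il <= 0.
  by rewrite -(pmulr_rle0 _ n_gt0) -lambda_sum -sumC; apply: ler_sum => i _.
have opp_min_le_max : - lambda 0 il <= lambda 0 i0.
  rewrite lerNl (nonneg_mx_eigenvalue_ge _ char_l max_ge0) //.
  - by move=> i j; rewrite mxE ler0n.
  - by move=> _ /mapP[i _ ->].
  - by rewrite map_f ?mem_enum.
have sqrt_gt0 : 0 < Num.sqrt (r * s) by rewrite sqrtr_gt0 mulr_gt0.
have energy_ge0 : 0 <= energy lambda by apply: sumr_ge0.
split; apply: majorized_nonincreasing => //; rewrite ?sum_scaled_nu //.
- by apply: scaled_nu_nonincreasing; rewrite divr_ge0 // ltW.
- move=> k k_bounds; rewrite prefix_sum_scaled_nu // divfK ?gt_eqF //.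
  by rewrite ler0_norm // (prefix_sum_ge (i0 := i0)).
- by apply: scaled_nu_nonincreasing; rewrite divr_ge0 ?mulr_ge0 // ltW.
- move=> k k_bounds; rewrite prefix_sum_scaled_nu // invfM mulrA.
  rewrite divfK ?gt_eqF //; exact: prefix_sum_le.
Qed.
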